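(* For every $F\in\mathbb V$, $$\Delta(F)\le C_\Phi .$$ Moreover, this inequality becomes an equality for $F=F_\Phi$ and for $F=\widetilde F_\Phi$, i.e. $\Delta(F_\Phi)=\Delta(\widetilde F_\Phi)=C_\Phi$.
   Context: Let $\mathbb V$ be the class of all distribution functions $F$ of real random variables with zero mean and unit variance. Denote $$\varphi(t)=\frac{1}{\sqrt{2\pi}}\,e^{-t^2/2},\qquad \Phi(x)=\int_{-\infty}^x\varphi(t)\,dt,\qquad \Delta(F)=\sup_{x\in\mathbb R}|F(x)-\Phi(x)|.$$ Let $\Psi(x)=\frac{1}{1+x^2}-\Phi(-|x|)$ for $x\in\mathbb R$. The number $C_\Phi=0.5409365\ldots$ is the maximum of $\Psi$ over $\mathbb R$; it is attained at the points $x_\Phi$ and $-x_\Phi$, where $x_\Phi=0.213105\ldots$ is the root of the equation $\frac{x e^{x^2/2}}{(1+x^2)^2}=\frac{1}{\sqrt{8\pi}}$ (so $C_\Phi=\Psi(x_\Phi)$). Let $X_\Phi$ be a random variable taking the two values $x_1=-\frac{1}{x_\Phi}$ and $x_2=x_\Phi$ with probabilities $p_1=\frac{x_\Phi^2}{1+x_\Phi^2}$ and $p_2=\frac{1}{1+x_\Phi^2}$ respectively. $F_\Phi$ denotes the distribution function of $X_\Phi$ and $\widetilde F_\Phi$ denotes the distribution function of $-X_\Phi$; both belong to $\mathbb V$. *)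

(* Defs.v *)
From HB Require Import structures.
From mathcomp Require Import all_boot all_order all_algebra.
From mathcomp Require Import all_classical all_reals all_analysis.
From mathcomp Require Import measurable_realfun.
From mathcomp Require Import ring lra.

Set Implicit Arguments.
Unset Strict Implicit.
Unset Printing Implicit Defensive.

Import Order.TTheory GRing.Theory Num.Def Num.Theory.
Import numFieldNormedType.Exports.

Local Open Scope classical_set_scope.
Local Open Scope ring_scope.

Section definitions.
Context {R : realType}.

(* Right-continuous convention: [dist_fun X x] is [P (X <= x)]. *)
Definition dist_fun d (T : measurableType d) (P : probability T R)
    (X : {RV P >-> R}) : R -> R :=
  fun x => fine (cdf X x).

(* In the library, a function whose positive and negative parts both have
   infinite integral has integral [-oo], so ['E_P[X] = 0] already implies that
   [X] is integrable. *)
Definition std_dist_fun (F : R -> R) : Prop :=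
  exists (d : measure_display) (T : measurableType d) (P : probability T R)
         (X : {RV P >-> R}),
    [/\ ('E_P[X] = 0)%E, ('V_P[X] = 1)%E & F = dist_fun X].

Definition phi (t : R) : R := (Num.sqrt (2 * pi))^-1 * expR (- t ^+ 2 / 2).

Definition Phi (x : R) : R := \int[lebesgue_measure]_(t in `]-oo, x]) phi t.

(* For a distribution function [F] the set is bounded by 1, hence this is the
   actual supremum and not the default value of [sup]. *)
Definition Delta (F : R -> R) : R := sup [set `|F x - Phi x| | x in [set: R]].

Definition Psi (x : R) : R := (1 + x ^+ 2)^-1 - Phi (- `|x|).

(* The supremum is a maximum: see [Psi_x_Phi]. *)
Definition C_Phi : R := sup (range Psi).

Definition root_eq (x : R) : Prop :=
  x * expR (x ^+ 2 / 2) / (1 + x ^+ 2) ^+ 2 = (Num.sqrt (8 * pi))^-1.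

(* The default value 0 is never used: see [root_eq_unique]. *)
Definition x_Phi : R := xget 0 [set x | root_eq x].

Definition p1_Phi : R := x_Phi ^+ 2 / (1 + x_Phi ^+ 2).
Definition p2_Phi : R := (1 + x_Phi ^+ 2)^-1.

(* [X_Phi] lives on [bool], where [true] has probability [p2_Phi] and [false]
   has probability [1 - p2_Phi], which is [p1_Phi]: see [X_Phi_law]. *)
Definition P_Phi : probability bool R := bernoulli_prob p2_Phi.

Definition X_Phi_fun (b : bool) : R := if b then x_Phi else - x_Phi^-1.

Lemma measurable_X_Phi : measurable_fun setT X_Phi_fun.
Proof. by []. Qed.

HB.instance Definition _ :=
  isMeasurableFun.Build _ _ _ _ X_Phi_fun measurable_X_Phi.

Definition X_Phi : {RV P_Phi >-> R} := X_Phi_fun.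

Definition F_Phi : R -> R := dist_fun X_Phi.

Definition F_Phi_tilde : R -> R := dist_fun (- X_Phi : {RV P_Phi >-> R}).

End definitions.

Section root.
Context {R : realType}.
Implicit Types x y : R.

Let g x := x * expR (x ^+ 2 / 2) / (1 + x ^+ 2) ^+ 2.
Let g' x := expR (x ^+ 2 / 2) * (1 - x ^+ 2) ^+ 2 / (1 + x ^+ 2) ^+ 3.
Let c : R := (Num.sqrt (8 * pi))^-1.

Let den_gt0 x : 0 < 1 + x ^+ 2.
Proof. by rewrite ltr_pwDl// sqr_ge0. Qed.

Let den_neq0 x : 1 + x ^+ 2 != 0.
Proof. by rewrite gt_eqF. Qed.

Let is_derive_half_sqr x : is_derive x 1 (fun y : R => y ^+ 2 / 2) x.
Proof. by apply: is_derive_eq; rewrite /GRing.scale/=; field. Qed.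

Let is_derive_g x : is_derive x 1 g (g' x).
Proof.
have he : is_derive x 1 (fun y : R => expR (y ^+ 2 / 2)) (expR (x ^+ 2 / 2) * x).
  exact: (@is_derive1_comp _ expR (fun y : R => y ^+ 2 / 2)).
have hd : is_derive x 1 (fun y : R => ((1 + y ^+ 2) ^+ 2)^-1)
    (- (4 * x) / (1 + x ^+ 2) ^+ 3).
  have h : (1 + x ^+ 2) ^+ 2 != 0 by rewrite expf_neq0.
  apply: is_derive_eq.
  by rewrite /GRing.scale/=; field.
rewrite /g /g'; apply: is_derive_eq; rewrite /GRing.scale/=.
by field.
Qed.

Let continuous_g : continuous g.
Proof.
move=> x; apply/differentiable_continuous/derivable1_diffP.
by have [] := is_derive_g x.
Qed.

Let g_nd x y : x <= y -> g x <= g y.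
Proof.
move=> xy; apply: (@ger0_derive1_ndecr _ g x y) => //.
- by move=> z _; have [] := is_derive_g z.
- move=> z _; rewrite derive1E; have [_ ->] := is_derive_g z.
  apply: divr_ge0; last exact/exprn_ge0/ltW.
  by apply: mulr_ge0; [exact: expR_ge0|exact: sqr_ge0].
- exact: continuous_subspaceT.
Qed.

Let g_incr x y : 0 <= x -> x < y -> y <= 1 -> g x < g y.
Proof.
move=> x0 xy y1; apply: (@gtr0_derive1_lt_cc _ g 0 1) => //.
- by move=> z _; have [] := is_derive_g z.
- move=> z; rewrite in_itv/= => /andP[z0 z1].
  rewrite derive1E; have [_ ->] := is_derive_g z.
  apply: divr_gt0; last exact: exprn_gt0.
  apply: mulr_gt0; first exact: expR_gt0.
  by rewrite exprn_gt0// subr_gt0 expr_lt1// ltW.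
- exact: continuous_subspaceT.
- by rewrite in_itv/= x0/= (le_trans (ltW xy)).
- by rewrite in_itv/= y1 andbT (le_trans x0)// ltW.
Qed.

Let c_gt0 : 0 < c.
Proof. by rewrite invr_gt0 sqrtr_gt0 mulr_gt0 ?pi_gt0. Qed.

Let c_lt_g1 : c < g 1.
Proof.
have s4 : 4 <= Num.sqrt (8 * pi) :> R.
  have -> : 4 = Num.sqrt (4 ^+ 2) :> R by rewrite sqrtr_sqr ger0_norm.
  by rewrite ler_wsqrtr//; have := @pi_ge2 R; lra.
have e1 : 1 < expR (1 ^+ 2 / 2) :> R by rewrite expR_gt1 expr1n.
apply: (@le_lt_trans _ _ (4^-1)).
  by rewrite /c lef_pV2 ?posrE//; exact: lt_le_trans s4.
rewrite /g; move: e1; set e := expR _ => e1.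
have -> : 1 * e / (1 + 1 ^+ 2) ^+ 2 = e / 4 by field.
by lra.
Qed.

Let gE x : root_eq x <-> g x = c.
Proof. by []. Qed.

Lemma root_eq_exists : exists x : R, 0 < x < 1 /\ root_eq x.
Proof.
have g0 : g 0 = 0 by rewrite /g !mul0r.
have [|x] := @IVT R g 0 1 c ler01 (continuous_subspaceT continuous_g).
  by rewrite g0 minElt maxElt (lt_trans c_gt0 c_lt_g1) !ltW.
rewrite in_itv/= => /andP[x0 x1] gxc; exists x; split => //.
rewrite !lt_neqAle x0 x1 !andbT; apply/andP; split.
  by apply/eqP => x0E; move: c_gt0; rewrite -gxc -x0E g0 ltxx.
by apply/eqP => x1E; move: c_lt_g1; rewrite -gxc x1E ltxx.
Qed.

Lemma root_eq_itv x : root_eq x -> 0 < x < 1.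
Proof.
move=> /gE gxc; apply/andP; split; rewrite ltNge; apply/negP => /g_nd.
  by rewrite gxc {1}/g !mul0r leNgt c_gt0.
by rewrite gxc leNgt c_lt_g1.
Qed.

Lemma root_eq_unique : exists! x : R, root_eq x.
Proof.
have [x [_ ex]] := root_eq_exists; exists x; split => // y ey.
have /andP[x0 x1] := root_eq_itv ex; have /andP[y0 y1] := root_eq_itv ey.
move/gE : ex; move/gE : ey => <- => gxy.
have [xy|yx|//] := ltgtP x y.
  by have := g_incr (ltW x0) xy (ltW y1); rewrite gxy ltxx.
by have := g_incr (ltW y0) yx (ltW x1); rewrite gxy ltxx.
Qed.

Lemma x_PhiP : root_eq (x_Phi : R).
Proof. by have [x [ex _]] := root_eq_unique; exact: (xgetI 0 ex). Qed.

Lemma x_Phi_gt0 : 0 < x_Phi :> R.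
Proof. by have /root_eq_itv/andP[] := x_PhiP. Qed.

Let g_x_Phi : g x_Phi = c. Proof. exact/gE/x_PhiP. Qed.

Lemma phiE : phi = normal_pdf 0 1 :> (R -> R).
Proof.
apply/funext => x; rewrite /phi normal_pdfE ?oner_neq0//.
rewrite /normal_peak /normal_fun subr0 expr1n mul1r.
by rewrite -(mulr_natl pi) mulNr.
Qed.

Lemma is_derive_Phi x : is_derive x 1 Phi (phi x).
Proof.
have [] := @continuous_FTC1 R phi -oo%O x (x + 1).
- by rewrite ltrDl.
- rewrite phiE; apply: integrableS (integrable_normal_pdf 0 1) => //.
- by rewrite ltNyr.
- by rewrite phiE; apply: continuous_normal_pdf; rewrite oner_neq0.
- by move=> d <-; rewrite derive1E; exact/derivableP.
Qed.

Let h x := (1 + x ^+ 2)^-1 - Phi (- x).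

Let phi_c x : phi x = 2 * c * expR (- x ^+ 2 / 2).
Proof.
rewrite /phi /c; congr (_ * _).
have -> : Num.sqrt (8 * pi) = 2 * Num.sqrt (2 * pi) :> R.
  have -> : 8 * pi = 2 ^+ 2 * (2 * pi) :> R by ring.
  by rewrite sqrtrM ?sqr_ge0// sqrtr_sqr ger0_norm.
by rewrite invfM mulrA mulfV ?mul1r.
Qed.

Let is_derive_h x : is_derive x 1 h (2 * expR (- x ^+ 2 / 2) * (c - g x)).
Proof.
have d0 := den_neq0 x.
have hP : is_derive x 1 (fun y => Phi (- y)) (phi x * -1).
  have -> : phi x = phi (- x) by rewrite /phi sqrrN.
  apply: (@is_derive1_comp _ Phi (-%R)); first exact: is_derive_Phi.
rewrite /h; apply: is_derive_eq.
have ee : expR (- x ^+ 2 / 2) * expR (x ^+ 2 / 2) = 1 :> R.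
  by rewrite -expRD mulNr addNr expR0.
rewrite phi_c /g /GRing.scale/=.
transitivity (2 * c * expR (- x ^+ 2 / 2) -
   2 * x / (1 + x ^+ 2) ^+ 2 * (expR (- x ^+ 2 / 2) * expR (x ^+ 2 / 2))).
  by rewrite ee; field.
by field.
Qed.

Let continuous_h : continuous h.
Proof.
move=> x; apply/differentiable_continuous/derivable1_diffP.
by have [] := is_derive_h x.
Qed.

Let Psi_h x : Psi x = h `|x|.
Proof. by rewrite /Psi /h real_normK// num_real. Qed.

Let h_le x : h x <= h x_Phi.
Proof.
have dh y : derivable h y 1 by have [] := is_derive_h y.
have h'E y : (h^`())%classic y = 2 * expR (- y ^+ 2 / 2) * (c - g y).
  by rewrite derive1E; have [_ ->] := is_derive_h y.
have e0 y : 0 <= 2 * expR (- y ^+ 2 / 2) :> R by rewrite mulr_ge0 ?expR_ge0.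
have [xx|/ltW xx] := leP x x_Phi.
- apply: (@ger0_derive1_ndecr _ h x x_Phi) => //.
    move=> y; rewrite in_itv/= => /andP[_ /ltW/g_nd].
    by rewrite g_x_Phi h'E => ?; rewrite mulr_ge0// subr_ge0.
  exact: continuous_subspaceT.
- apply: (@ler0_derive1_nincry _ h x_Phi) => //.
    move=> y; rewrite in_itv/= andbT => /ltW/g_nd.
    by rewrite g_x_Phi h'E => ?; rewrite mulr_ge0_le0// subr_le0.
  exact: continuous_subspaceT.
Qed.

Lemma Psi_le_x_Phi x : Psi x <= Psi x_Phi.
Proof. by rewrite !Psi_h (ger0_norm (ltW x_Phi_gt0)). Qed.

Lemma PsiN x : Psi (- x) = Psi x.
Proof. by rewrite /Psi sqrrN normrN. Qed.

Lemma Psi_x_Phi : Psi x_Phi = C_Phi :> R.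
Proof.
apply/eqP; rewrite eq_le; apply/andP; split.
  apply: ub_le_sup; last by exists x_Phi.
  by exists (Psi x_Phi) => _ [x _ <-]; exact: Psi_le_x_Phi.
apply: ge_sup; first by exists (Psi x_Phi); exists x_Phi.
by move=> _ [x _ <-]; exact: Psi_le_x_Phi.
Qed.

End root.

Section two_point.
Context {R : realType}.
Local Notation x := (@x_Phi R).

Let den_neq0 : 1 + x ^+ 2 != 0.
Proof. by rewrite gt_eqF// ltr_pwDl// sqr_ge0. Qed.

Let x_neq0 : x != 0.
Proof. by rewrite gt_eqF// x_Phi_gt0. Qed.

Lemma p1_PhiE : @p1_Phi R = 1 - p2_Phi.
Proof. by rewrite /p1_Phi /p2_Phi; field. Qed.

Lemma p2_Phi_itv : 0 <= @p2_Phi R <= 1.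
Proof.
have d1 : 1 <= 1 + x ^+ 2 by rewrite lerDl sqr_ge0.
by rewrite /p2_Phi invr_ge0 (le_trans ler01)//= invf_le1// (lt_le_trans ltr01).
Qed.

Lemma X_Phi_law :
  @P_Phi R (@X_Phi R @^-1` [set - x^-1]) = (@p1_Phi R)%:E /\
  @P_Phi R (@X_Phi R @^-1` [set x]) = (@p2_Phi R)%:E.
Proof.
have xN : - x^-1 != x.
  by rewrite lt_eqF// (@lt_trans _ _ 0) ?x_Phi_gt0// oppr_lt0 invr_gt0 x_Phi_gt0.
split; rewrite /P_Phi /= bernoulli_probE ?p2_Phi_itv// !diracE.
- rewrite (memNset (_ : ~ _ true)) ?(mem_set (_ : _ false))//=.
    by rewrite mule0 add0e mule1 p1_PhiE.
  by move=> /esym/eqP; rewrite (negbTE xN).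
- rewrite (memNset (_ : ~ _ false)) ?(mem_set (_ : _ true))//=.
    by rewrite mule0 adde0 mule1.
  by move=> /eqP; rewrite (negbTE xN).
Qed.

Let expectation_bool (f : bool -> R) :
  ('E_(@P_Phi R)[f] = (p2_Phi * f true + p1_Phi * f false)%:E)%E.
Proof.
pose M : R := `|f true| + `|f false|.
have mf : measurable_fun setT f by [].
have fM b : 0 <= f b + M.
  have := normr_ge0 (f true); have := normr_ge0 (f false).
  have := ler_norm (- f b); rewrite normrN /M; case: b; lra.
have If : (@P_Phi R).-integrable setT (EFin \o f).
  apply: measurable_bounded_integrable => //.
    exact: le_lt_trans (probability_le1 _ measurableT) (ltry 1).
  exists M; split; first exact: num_real.
  move=> N MN b _; apply: (le_trans _ (ltW MN)).
  have := normr_ge0 (f true); have := normr_ge0 (f false).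
  by rewrite /M; case: b; lra.
have : (\int[@P_Phi R]_b (f b + M)%:E = 'E_(@P_Phi R)[f] + M%:E)%E.
  rewrite unlock -[in RHS](mule1 M%:E) -(probability_setT (@P_Phi R)).
  rewrite -integral_cst// -integralD//.
  exact: finite_measure_integrable_cst.
rewrite integral_bernoulli_prob ?p2_Phi_itv// => H.
rewrite -['E_(@P_Phi R)[f]%E](@addeK _ M%:E)// -H -!EFinM -!EFinD.
by congr EFin; rewrite p1_PhiE /unstable.onem; ring.
Qed.

Lemma std_dist_fun_F_Phi : std_dist_fun (@F_Phi R).
Proof.
have x0 := x_neq0; have d0 := den_neq0.
have E0 : ('E_(@P_Phi R)[@X_Phi R] = 0)%E.
  rewrite expectation_bool; congr EFin => /=.
  by rewrite /X_Phi_fun /p1_Phi /p2_Phi; field; rewrite x0 d0.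
exists _, bool, (@P_Phi R), X_Phi; split => //.
rewrite /variance unlock E0/= expectation_bool; congr EFin => /=.
rewrite !fctE /= /p1_Phi /p2_Phi; move: x0 d0; move: (x) => a a0 d0.
by field; rewrite a0 d0.
Qed.

Lemma std_dist_fun_F_Phi_tilde : std_dist_fun (@F_Phi_tilde R).
Proof.
have x0 := x_neq0; have d0 := den_neq0.
have E0 : ('E_(@P_Phi R)[(- @X_Phi R : {RV (@P_Phi R) >-> R})%R] = 0)%E.
  rewrite mfunN expectation_bool; congr EFin => /=.
  by rewrite /X_Phi_fun /p1_Phi /p2_Phi; field; rewrite x0 d0.
exists _, bool, (@P_Phi R), (- X_Phi : {RV (@P_Phi R) >-> R}); split => //.
rewrite /variance unlock E0 mfunN/= expectation_bool; congr EFin => /=.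
rewrite !fctE /= /p1_Phi /p2_Phi; move: x0 d0; move: (x) => a a0 d0.
by field; rewrite a0 d0.
Qed.

End two_point.

(* Main.v *)
Require Import Defs.
From HB Require Import structures.
From mathcomp Require Import all_boot all_order all_algebra.
From mathcomp Require Import all_classical all_reals all_analysis.
From mathcomp Require Import measurable_realfun.
From mathcomp Require Import ring lra.

Set Implicit Arguments.
Unset Strict Implicit.
Unset Printing Implicit Defensive.

Import Order.TTheory GRing.Theory Num.Theory.
Import numFieldNormedType.Exports.
Local Open Scope ring_scope.
Local Open Scope classical_set_scope.

(** The bound holds pointwise: [`|F x - Phi x| <= C_Phi] for every [x].
    Let first [x <= 0].  Cantelli's one-sided inequality for a standardized
    variable gives [F x <= (1 + x ^+ 2)^-1] ([std_dist_fun_le]), hence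
    [F x - Phi x <= Psi x <= C_Phi]; the opposite difference is at most [Phi x <= 1 / 2], and [1 / 2 = Psi 0 <= C_Phi].  For
    [x >= 0] the roles of the two differences are exchanged ([std_dist_fun_ge])
    and [Phi (- x) = 1 - Phi x] ([PhiN]) brings back [Psi].

    The two-point law turns Cantelli's inequality into an equality at the
    maximizer of [Psi].  With right-continuous distribution functions, the law
    of [- X_Phi] attains [C_Phi] at the atom [- x_Phi], whereas [F_Phi] jumps
    upwards at [x_Phi]: there [C_Phi] is only the limit of [Phi y - F_Phi y] as
    [y] tends to [x_Phi] from the left, where [F_Phi y = p1_Phi]. *)

Lemma phi_ge0 (R : realType) (x : R) : 0 <= phi x.
Proof. by rewrite phiE normal_pdf_ge0. Qed.

Lemma integral_Phi (R : realType) (x : R) :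
  (\int[lebesgue_measure]_(t in `]-oo, x]) (phi t)%:E)%E = (Phi x)%:E.
Proof.
rewrite /Phi /Rintegral fineK//; apply: integrable_fin_num => //.
by rewrite phiE; apply: integrableS (integrable_normal_pdf 0 1).
Qed.

(** The substitution [t -> - t] maps the lower tail at [- x] to the upper tail
    at [x], and the two tails at [x] add up to the total mass 1. *)
Lemma PhiN (R : realType) (x : R) : Phi (- x) = 1 - Phi x.
Proof.
have cphi : continuous (@phi R).
  by rewrite phiE; apply: continuous_normal_pdf; rewrite oner_neq0.
have mphi A : measurable_fun A (EFin \o @phi R).
  by rewrite phiE; apply/measurable_EFinP; apply: measurable_funTS;
    exact: measurable_normal_pdf.
suff : ((Phi x)%:E + (Phi (- x))%:E = 1)%E.
  by rewrite -EFinD => -[<-]; rewrite addrAC subrr add0r.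
rewrite -!integral_Phi (@ge0_integration_by_substitutionNy _ phi); last 2 first.
- exact: continuous_subspaceT.
- by move=> t _; exact: phi_ge0.
have phiN : phi \o -%R = phi :> (R -> R).
  by apply/funext => t; rewrite /= /phi sqrrN.
rewrite phiN.
rewrite -integral_itv_obnd_cbnd; last exact: mphi.
rewrite -ge0_integral_setU//=.
- by rewrite -itv_bndbnd_setU// set_itvE phiE integral_normal_pdf ?oner_neq0.
- exact: mphi.
- by move=> t _; rewrite lee_fin phi_ge0.
- apply/disj_setPS => t [] /=; rewrite !in_itv/= andbT => tx.
  by rewrite ltNge tx.
Qed.

Lemma Phi0 (R : realType) : Phi 0 = 2^-1 :> R.
Proof. by have := @PhiN R 0; rewrite oppr0; lra. Qed.

Lemma continuous_Phi (R : realType) : continuous (@Phi R).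
Proof.
move=> x; apply/differentiable_continuous/derivable1_diffP.
by have [] := is_derive_Phi x.
Qed.

Lemma Phi_nd (R : realType) (x y : R) : x <= y -> Phi x <= Phi y.
Proof.
move=> xy; apply: (@ger0_derive1_ndecr _ (@Phi R) x y) => //.
- by move=> z _; have [] := is_derive_Phi z.
- by move=> z _; rewrite derive1E; have [_ ->] := is_derive_Phi z; exact: phi_ge0.
- exact/continuous_subspaceT/continuous_Phi.
Qed.

Lemma Phi_ge0 (R : realType) (x : R) : 0 <= Phi x.
Proof.
by rewrite /Phi /Rintegral fine_ge0// integral_ge0// => t _; rewrite lee_fin phi_ge0.
Qed.

(** [Psi 0 = 1 / 2]. *)
Lemma half_le_C_Phi (R : realType) : 2^-1 <= C_Phi :> R.
Proof.
rewrite -Psi_x_Phi; apply: le_trans (Psi_le_x_Phi 0).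
by rewrite /Psi normr0 oppr0 Phi0 expr0n/= addr0 invr1; lra.
Qed.

(** A variable of mean 0 and variance 1 is square-integrable: centering by the
    mean changes nothing, so the variance is the second moment itself. *)
Lemma standard_Lfun2 (R : realType) (d : measure_display)
    (T : measurableType d) (P : probability T R) (X : {RV P >-> R}) :
  ('E_P[X] = 0)%E -> ('V_P[X] = 1)%E -> (X : T -> R) \in Lfun P 2%:E.
Proof.
move=> E0 V1; rewrite inE; apply/andP; split.
  by rewrite inE/=; exact: measurable_funPT.
rewrite inE/= /finite_norm unlock poweR_lty//.
suff -> : (\int[P]_x (`|(X x)%:E| `^ 2) = 'V_P[X])%E by rewrite V1 ltry.
rewrite /variance unlock E0/= unlock; apply: eq_integral => t _.
by rewrite !fctE/= subr0 powR_mulrn// real_normK ?num_real.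
Qed.

(** Cantelli's inequality at mean 0 and variance 1, with the trivial bound 1
    included as the case [a = 0]. *)
Lemma cantelli_standard (R : realType) (d : measure_display)
    (T : measurableType d) (P : probability T R) (X : {RV P >-> R}) (a : R) :
  ('E_P[X] = 0)%E -> ('V_P[X] = 1)%E -> 0 <= a ->
  (P (X @^-1` `[a, +oo[) <= (1 + a ^+ 2)^-1%:E)%E.
Proof.
move=> E0 V1; rewrite le_eqVlt => /predU1P[<-|a0].
  by rewrite expr0n/= addr0 invr1; apply: probability_le1; exact: measurable_funPTI.
have := cantelli (standard_Lfun2 E0 V1) a0; rewrite E0 V1/= div1r.
under eq_set => t do rewrite sube0 lee_fin.
by rewrite preimage_itvcy.
Qed.

(** Cantelli's inequality for [- X] at [- x]. *)
Lemma std_dist_fun_le (R : realType) (F : R -> R) (x : R) :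
  std_dist_fun F -> x <= 0 -> F x <= (1 + x ^+ 2)^-1.
Proof.
move=> [d [T [P [X [E0 V1 ->]]]]] x0.
have X2 := standard_Lfun2 E0 V1.
have X1 := Lfun_subset12 (fin_num_measure P _ measurableT) X2.
have EN : ('E_P[(- X : {RV P >-> R})%R] = 0)%E.
  have XN : \- X = -1 \o* X by apply/funext => t; rewrite /= mulrN1.
  by rewrite mfunN XN expectationZl// E0 mule0.
have VN : ('V_P[(- X : {RV P >-> R})%R] = 1)%E by rewrite mfunN varianceN.
have xN0 : 0 <= - x by rewrite oppr_ge0.
have := cantelli_standard EN VN xN0; rewrite sqrrN => le1.
rewrite /dist_fun -lee_fin fineK ?fin_num_measure//.
apply: le_trans le1; rewrite /cdf /distribution /pushforward.
rewrite le_eqVlt; apply/orP; left; apply/eqP; congr (P _).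
by apply/funext => t; rewrite mfunN /= !in_itv/= andbT lerN2.
Qed.

(** Cantelli's inequality for [X] at [x]: the event [X > x], of probability
    [1 - F x], is contained in [X >= x]. *)
Lemma std_dist_fun_ge (R : realType) (F : R -> R) (x : R) :
  std_dist_fun F -> 0 <= x -> 1 - (1 + x ^+ 2)^-1 <= F x.
Proof.
move=> [d [T [P [X [E0 V1 ->]]]]] x0.
have le1 := cantelli_standard E0 V1 x0.
rewrite /dist_fun lerBlDr -lerBlDl -lee_fin EFinB fineK ?fin_num_measure//.
apply: le_trans le1; rewrite /cdf /distribution /pushforward.
rewrite -probability_setC; last exact: measurable_funPTI.
apply: le_measure; rewrite ?inE.
- by apply: measurableC; exact: measurable_funPTI.
- exact: measurable_funPTI.
- by move=> t /=; rewrite !in_itv/= andbT => /negP; rewrite -ltNge => /ltW.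
Qed.

(** The pointwise form of the upper bound. *)
Lemma std_dist_fun_dist_Phi (R : realType) (F : R -> R) (x : R) :
  std_dist_fun F -> `|F x - Phi x| <= C_Phi.
Proof.
move=> sF.
have F01 : 0 <= F x <= 1.
  have [d [T [P [X [_ _ ->]]]]] := sF.
  by rewrite fine_ge0//= -lee_fin fineK ?fin_num_measure ?cdf_le1.
have P0 := Phi_ge0 x; have Ch := half_le_C_Phi R.
have PsiC : Psi x <= C_Phi by rewrite -Psi_x_Phi Psi_le_x_Phi.
have PN := PhiN x; have H0 := Phi0 R.
rewrite ler_norml; have [x0|/ltW x0] := leP x 0.
- have := std_dist_fun_le sF x0; have := Phi_nd x0.
  by move: PsiC; rewrite /Psi ler0_norm// opprK; lra.
- have := std_dist_fun_ge sF x0; have := Phi_nd x0.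
  by move: PsiC; rewrite /Psi ger0_norm//; lra.
Qed.

Lemma Delta_std_le (R : realType) (F : R -> R) :
  std_dist_fun F -> Delta F <= C_Phi.
Proof.
move=> sF; apply: ge_sup; first by exists `|F 0 - Phi 0|, 0.
by move=> _ [x _ <-]; exact: std_dist_fun_dist_Phi.
Qed.

Lemma dist_Phi_le_Delta (R : realType) (F : R -> R) (x : R) :
  std_dist_fun F -> `|F x - Phi x| <= Delta F.
Proof.
move=> sF; apply: ub_le_sup; last by exists x.
by exists C_Phi => _ [y _ <-]; exact: std_dist_fun_dist_Phi.
Qed.

Lemma C_PhiE (R : realType) : C_Phi = p2_Phi - Phi (- x_Phi) :> R.
Proof. by rewrite -Psi_x_Phi /Psi gtr0_norm ?x_Phi_gt0. Qed.

Lemma F_PhiE (R : realType) (y : R) : - x_Phi^-1 <= y -> y < x_Phi ->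
  F_Phi y = p1_Phi.
Proof.
move=> y1 y2; rewrite /F_Phi /dist_fun /cdf /distribution /pushforward.
rewrite /P_Phi /= bernoulli_probE ?p2_Phi_itv// !diracE.
rewrite (memNset (_ : ~ _ true)) ?(mem_set (_ : _ false))//=.
- by rewrite mulr0 add0r mulr1 p1_PhiE.
- by rewrite in_itv/= leNgt y2.
Qed.

Lemma F_Phi_tildeE (R : realType) : F_Phi_tilde (- x_Phi) = p2_Phi :> R.
Proof.
rewrite /F_Phi_tilde /dist_fun /cdf /distribution /pushforward mfunN.
rewrite /P_Phi /= bernoulli_probE ?p2_Phi_itv// !diracE.
rewrite (memNset (_ : ~ _ false)) ?(mem_set (_ : _ true))//=.
- by rewrite mulr0 addr0 mulr1.
- by rewrite in_itv/=.
- rewrite in_itv/= opprK; apply/negP; rewrite -ltNge.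
  by rewrite (@lt_trans _ _ 0) ?invr_gt0 ?oppr_lt0 ?x_Phi_gt0.
Qed.

Lemma Delta_F_Phi (R : realType) : Delta (@F_Phi R) = C_Phi.
Proof.
apply/eqP; rewrite eq_le Delta_std_le/=; last exact: std_dist_fun_F_Phi.
have xNx : - x_Phi^-1 < x_Phi :> R.
  by rewrite (@lt_trans _ _ 0) ?oppr_lt0 ?invr_gt0 ?x_Phi_gt0.
have -> : C_Phi = Phi x_Phi - p1_Phi :> R.
  by rewrite C_PhiE PhiN p1_PhiE; ring.
apply: (@cvgr_to_le _ (x_Phi^'-) _ _ (fun y => Phi y - p1_Phi)).
  apply: cvgB; last exact: cvg_cst.
  exact/cvg_at_left_filter/continuous_Phi.
near=> y.
have ly : - x_Phi^-1 <= y.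
  by near: y; apply: nbhs_left_ge.
have yx : y < x_Phi by near: y; exact: nbhs_left_lt.
rewrite -(F_PhiE ly yx); apply: le_trans (dist_Phi_le_Delta y _).
  by rewrite distrC ler_norm.
exact: std_dist_fun_F_Phi.
Unshelve. all: by end_near. Qed.

Lemma Delta_F_Phi_tilde (R : realType) : Delta (@F_Phi_tilde R) = C_Phi.
Proof.
apply/eqP; rewrite eq_le Delta_std_le/=; last exact: std_dist_fun_F_Phi_tilde.
rewrite C_PhiE -F_Phi_tildeE.
apply: le_trans (dist_Phi_le_Delta (- x_Phi) (@std_dist_fun_F_Phi_tilde R)).
exact: ler_norm.
Qed.

Theorem mainTheorem1 (R : realType) :
  (forall F : R -> R, std_dist_fun F -> Delta F <= C_Phi) /\
  (Delta (@F_Phi R) = C_Phi /\ Delta (@F_Phi_tilde R) = C_Phi).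
Proof.
split; first exact: Delta_std_le.
by split; [exact: Delta_F_Phi|exact: Delta_F_Phi_tilde].
Qed.
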